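(* Fix $A,r,g,\ell$ as in the context. 1. For a given $\rho$, there exist vectors $u_1,u_2\in\mathbb R^{n+1}$ and scalars $D_1,D_2\in\mathbb R$, which depend only on $S$, such that $$\begin{pmatrix}x_S(\lambda)\\-\mu_{S^c}(\lambda)\\\mu_0(\lambda)\end{pmatrix}=\frac{u_1-u_2\lambda}{D_1-D_2\lambda}$$ (as $\lambda$ varies with the support $S$ held fixed). 2. For a given $\lambda$, there exist vectors $\tilde u_1,\tilde u_2\in\mathbb R^{n+1}$, which depend only on $S$, such that $$\begin{pmatrix}x_S(\rho)\\-\mu_{S^c}(\rho)\\\mu_0(\rho)\end{pmatrix}=\tilde u_1-\tilde u_2\rho$$ (as $\rho$ varies with the support $S$ held fixed).
   Context: Let $A\in\mathbb R^{n\times n}$ be symmetric positive definite and $r,g,\ell\in\mathbb R^n$. For $\lambda,\rho\in[0,1]$ let $A(\lambda)=A+\lambda gg^T$ and $r(\rho)=r+\rho\ell$. Let $x(\lambda,\rho)$ be the minimizer of $\frac12x^TA(\lambda)x-r(\rho)^Tx$ over the simplex $\Delta_n=\{x\in\mathbb R^n:\sum_ix_i=1,\ x_i\ge0\}$, with Lagrange multipliers $\mu_0\in\mathbb R$, $\mu\in\mathbb R^n_{\ge0}$ defined by the KKT conditions $A(\lambda)x-\mu_0\mathbf 1-\mu-r(\rho)=0$, $\mathbf 1^Tx=1$, $\mu_ix_i=0$, $x_i\ge 0$. Here $\mathbf 1$ is the all-ones vector. Let $S$ be the support of $x(\lambda,\rho)$. Subscripts $S,S^c$ denote restriction to the corresponding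 indices or blocks. Then $x_{S^c}=0$, $\mu_S=0$ and $$\mu_0=\frac{1-\mathbf 1_S^TA(\lambda)_{SS}^{-1}r(\rho)_S}{\mathbf 1_S^TA(\lambda)_{SS}^{-1}\mathbf 1_S},\qquad x_S=\mu_0A(\lambda)_{SS}^{-1}\mathbf 1_S+A(\lambda)_{SS}^{-1}r(\rho)_S,$$ $$\mu_{S^c}=A(\lambda)_{S^cS}x_S-\mu_0\mathbf 1_{S^c}-r(\rho)_{S^c}.$$ The functions in the claim are these quantities as functions of $\lambda$ (for given $\rho$) or of $\rho$ (for given $\lambda$), over parameter values for which the support is $S$. ''Depend only on $S$'' means: given the fixed data $A,r,g,\ell$ and the fixed other parameter, the vectors and scalars are determined by $S$ and do not depend on the varying parameter. *)

(* Defs.v *)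
From mathcomp Require Import all_boot all_order all_algebra.
From mathcomp Require Import reals.

Set Implicit Arguments.
Unset Strict Implicit.
Unset Printing Implicit Defensive.

Import Order.TTheory GRing.Theory Num.Theory.
Local Open Scope ring_scope.

Section QuadraticProgram.
Variables (R : realType) (n : nat).
Implicit Types (M : 'M[R]_n) (b x y mu : 'cV[R]_n) (S : {set 'I_n}).

Definition spd M : Prop :=
  M^T = M /\ forall x, x != 0 -> 0 < (x^T *m M *m x) 0 0.

Definition A_at M (g : 'cV[R]_n) (lam : R) : 'M[R]_n := M + lam *: (g *m g^T).

Definition r_at b (l : 'cV[R]_n) (rho : R) : 'cV[R]_n := b + rho *: l.

Definition in_simplex x : Prop := \sum_i x i 0 = 1 /\ forall i, 0 <= x i 0.

Definition objective M b x : R :=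
  2^-1 * (x^T *m M *m x) 0 0 - (b^T *m x) 0 0.

Definition is_minimizer M b x : Prop :=
  in_simplex x /\ forall y, in_simplex y -> objective M b x <= objective M b y.

Definition KKT M b x (mu0 : R) mu : Prop :=
  [/\ M *m x - mu0 *: const_mx 1 - mu - b = 0,
      \sum_i x i 0 = 1,
      forall i, mu i 0 * x i 0 = 0,
      forall i, 0 <= x i 0
    & forall i, 0 <= mu i 0].

Definition is_solution M b x (mu0 : R) mu : Prop :=
  is_minimizer M b x /\ KKT M b x mu0 mu.

Definition supp_set x : {set 'I_n} := [set i | x i 0 != 0].

Definition restr S x : 'cV[R]_#|S| := rowsub (@enum_val _ (mem S)) x.

Lemma stack_dim S : (#|S| + #|~: S| + 1 = n + 1)%N.
Proof. by rewrite cardsC card_ord. Qed.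

(* The vector (x_S ; - mu_{S^c} ; mu_0), cast from R^(|S| + |S^c| + 1) to
   R^(n + 1); the blocks x_S and mu_{S^c} list their indices in increasing
   order. *)
Definition stack S x mu (mu0 : R) : 'cV[R]_(n + 1) :=
  castmx (stack_dim S, erefl 1%N)
    (col_mx (col_mx (restr S x) (- restr (~: S) mu)) mu0%:M).

End QuadraticProgram.

(* Main.v *)
Require Import Defs.
From HB Require Import structures.
From mathcomp Require Import all_boot all_order all_algebra.
From mathcomp Require Import reals.

(** The conditions [mu_i * x_i = 0] make [x] and [mu] live on complementary
    sets of coordinates, so the single vector [y = x - mu] contains both: with
    [P] the coordinate projection onto the support [S], [x = P y] and
    [- mu = (1 - P) y].  For a fixed support the KKT equations therefore become
    a square linear system in [z = (y ; mu_0)],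
<<
      [ A(lambda) P + (1 - P)   -1 ] [  y   ]   [ r(rho) ]
      [        1^T P             0 ] [ mu_0 ] = [   1    ],
>>
    and the stacked vector of the theorem is a fixed linear image of [z].

    The matrix of this system is invertible as soon as [S] is nonempty and
    [A(lambda)] is positive definite ([kkt_mx_unit]); an empty support is
    excluded by [sum_i x_i = 1].  In [rho] only the right-hand side moves, and
    it moves affinely, whence the second claim.  In [lambda] the matrix
    undergoes a rank-one perturbation, and the Sherman-Morrison formula
    ([rank_one_update_sol]) shows that the solution is a quotient of two affine
    functions with a scalar denominator, whence the first claim. *)

Set Implicit Arguments.
Unset Strict Implicit.

Import Order.TTheory GRing.Theory Num.Theory.
Local Open Scope ring_scope.

(** * Linear systems *)

Lemma unitmx_of_ker0 (F : fieldType) (m : nat) (K : 'M[F]_m) :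
  (forall z : 'cV_m, K *m z = 0 -> z = 0) -> K \in unitmx.
Proof.
move=> K0; rewrite -unitmx_tr -row_free_unit -kermx_eq0.
apply/rowV0P => v /sub_kermxP vK.
apply: trmx_inj; rewrite trmx0; apply: K0.
by apply: trmx_inj; rewrite trmx_mul trmxK vK trmx0.
Qed.

(** Sherman-Morrison.  If the denominator vanished, then [K^-1 p] would be a
    nonzero kernel vector of the perturbed matrix.  Given this, apply [q] to
    [z = K^-1 c - t (q z) K^-1 p], solve for the scalar [q z], and substitute
    it back. *)
Lemma rank_one_update_sol (F : fieldType) (m : nat) (K : 'M[F]_m)
    (p c z : 'cV_m) (q : 'rV_m) (t : F) :
  let a := invmx K *m c in let b := invmx K *m p in
  let qa := (q *m a) 0 0 in let qb := (q *m b) 0 0 in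
  K \in unitmx -> K + t *: (p *m q) \in unitmx ->
  (K + t *: (p *m q)) *m z = c ->
  1 + t * qb != 0 /\
  z = (1 + t * qb)^-1 *: (a - t *: (qa *: b - qb *: a)).
Proof.
move=> a b qa qb Ku Ktu Kz.
have mul_q (v w : 'cV[F]_m) : v *m (q *m w) = (q *m w) 0 0 *: v.
  by rewrite [q *m w]mx11_scalar mul_mx_scalar !mxE.
have D0 : 1 + t * qb != 0.
  apply/eqP => D0.
  have Kb : (K + t *: (p *m q)) *m b = 0.
    rewrite mulmxDl -scalemxAl -mulmxA mul_q -/qb mulKVmx // scalerA.
    by rewrite -[X in X + _]scale1r -scalerDl D0 scale0r.
  have b0 : b = 0 by rewrite -(mulKmx Ktu b) Kb mulmx0.
  move: D0; rewrite /qb b0 mulmx0 mxE mulr0 addr0.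
  by apply/eqP; rewrite oner_neq0.
split=> //.
set s := (q *m z) 0 0.
have zE : z = a - (t * s) *: b.
  apply: (can_inj (mulKmx Ku)).
  rewrite mulmxBr -scalemxAr /a /b !mulKVmx // -Kz mulmxDl -scalemxAl -mulmxA.
  by rewrite mul_q -/s scalerA addrK.
have sE : (1 + t * qb) * s = qa.
  have : s = qa - t * s * qb.
    rewrite /s {1}zE mulmxBr -scalemxAr.
    by rewrite [LHS]mxE [X in _ + X]mxE [X in - X]mxE.
  by move=> sE; rewrite mulrDl mul1r {1}sE mulrAC subrK.
apply: (scalerI D0); rewrite scalerA mulfV // scale1r {1}zE -sE.
rewrite !scalerBr !scalerA scalerDl scale1r opprB -addrA; congr (_ + _).
by congr (_ - _ *: _); rewrite mulrCA mulrA.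
Qed.

(** * The KKT system with a given support *)

Lemma spd_A_at (R : realType) (n : nat) (A : 'M[R]_n) (g : 'cV[R]_n) lam :
  spd A -> 0 <= lam -> spd (A_at A g lam).
Proof.
case=> AT Apos lam0; split=> [|x x0].
  by rewrite /A_at linearD linearZ /= trmx_mul trmxK AT.
rewrite /A_at mulmxDr mulmxDl mxE ltr_wpDr ?Apos //.
rewrite -scalemxAr -scalemxAl mxE mulr_ge0 //.
(* x^T g g^T x is the square of the scalar g^T x *)
have -> : x^T *m (g *m g^T) *m x = (g^T *m x)^T *m (g^T *m x).
  by rewrite trmx_mul trmxK !mulmxA.
by rewrite mxE sumr_ge0 // => i _; rewrite mxE -expr2 sqr_ge0.
Qed.

Definition supp_proj (R : realType) (n : nat) (S : {set 'I_n}) : 'M[R]_n :=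
  diag_mx (\row_i (i \in S)%:R).
Arguments supp_proj {R n} S.

Lemma supp_projE (R : realType) (n : nat) (S : {set 'I_n}) (y : 'cV[R]_n) i :
  (supp_proj S *m y) i 0 = (i \in S)%:R * y i 0.
Proof. by rewrite /supp_proj mul_diag_mx !mxE. Qed.

Definition kkt_mx (R : realType) (n : nat) (S : {set 'I_n}) (M : 'M[R]_n) :
    'M[R]_(n + 1) :=
  block_mx (M *m supp_proj S + (1%:M - supp_proj S)) (- const_mx 1)
           (const_mx 1 *m supp_proj S) 0.

Definition kkt_rhs (R : realType) (n : nat) (b : 'cV[R]_n) : 'cV[R]_(n + 1) :=
  col_mx b 1%:M.

Definition kkt_vec (R : realType) (n : nat) (x mu : 'cV[R]_n) (mu0 : R) :
    'cV[R]_(n + 1) :=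
  col_mx (x - mu) mu0%:M.

(** Let [(y ; t)] be in the kernel, and put [x = P y], [nu = (1 - P) y].
    Pairing [M x + nu = t 1] with [x] kills [nu] (disjoint supports) and the
    right-hand side ([1^T x = 0]), so [x = 0] by definiteness.  Then
    [nu = t 1], and since [nu] vanishes at any index of [S], [t = 0]. *)
Lemma kkt_mx_unit (R : realType) (n : nat) (S : {set 'I_n}) (M : 'M[R]_n) :
  spd M -> S != set0 -> kkt_mx S M \in unitmx.
Proof.
case=> _ Mpos /set0Pn[i0 i0S]; apply: unitmx_of_ker0 => z.
rewrite -(vsubmxK z); move: (usubmx z) (dsubmx z) => y t1.
rewrite (mx11_scalar t1); move: (t1 0 0) => t {z t1}.
rewrite /kkt_mx mul_block_col -[0 in RHS]vsubmxK => /eq_col_mx[].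
rewrite !linear0 mulNmx mul_mx_scalar mul0mx addr0 mulmxDl mulmxBl mul1mx.
rewrite -!mulmxA; set x := supp_proj S *m y => /eqP.
rewrite subr_eq0 => /eqP stat sum0.
have xnu : x^T *m (y - x) = 0.
  apply/matrixP=> i j; rewrite !ord1 mxE [RHS]mxE big1 // => k _.
  rewrite [x^T _ _]mxE [(y - x) _ _]mxE [(- x) _ _]mxE supp_projE.
  by case: (k \in S); rewrite ?mul1r ?subrr ?mulr0 ?mul0r.
have x1 : x^T *m (const_mx 1 : 'cV[R]_n) = 0.
  by apply: trmx_inj; rewrite trmx_mul trmxK trmx_const sum0 trmx0.
have x0 : x = 0.
  apply/eqP; apply: contraT => /Mpos.
  have /(congr1 (mulmx x^T)) := stat.
  rewrite mulmxDr xnu addr0 mulmxA -scalemxAr x1 scaler0 => ->.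
  by rewrite mxE ltxx.
have yi0 : y i0 0 = 0.
  by move: (supp_projE S y i0); rewrite -/x x0 i0S mul1r mxE.
move: stat; rewrite x0 mulmx0 add0r subr0 => yE.
have t0 : t = 0 by move: yi0; rewrite yE !mxE mulr1.
by rewrite yE t0 scale0r raddf0 col_mx0.
Qed.

Lemma kkt_vec_proj (R : realType) (n : nat) (M : 'M[R]_n) (b x mu : 'cV[R]_n)
    mu0 :
  KKT M b x mu0 mu -> supp_proj (supp_set x) *m (x - mu) = x.
Proof.
case=> _ _ compl _ _; apply/matrixP=> i j; rewrite ord1 supp_projE !mxE inE.
have [->|x0] := eqVneq (x i 0) 0; first by rewrite mul0r.
move/eqP: (compl i); rewrite mulf_eq0 (negPf x0) orbF => /eqP->.
by rewrite subr0 mul1r.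
Qed.

Lemma kkt_mx_sol (R : realType) (n : nat) (M : 'M[R]_n) (b x mu : 'cV[R]_n)
    mu0 :
  KKT M b x mu0 mu ->
  kkt_mx (supp_set x) M *m kkt_vec x mu mu0 = kkt_rhs b.
Proof.
move=> kkt; have Py := kkt_vec_proj kkt.
case: kkt => stat sum1 _ _ _.
rewrite /kkt_mx /kkt_vec /kkt_rhs mul_block_col mulmxDl mulmxBl mul1mx.
rewrite -!mulmxA Py mulNmx mul_mx_scalar mul0mx addr0; congr col_mx.
  apply/eqP; rewrite -subr_eq0 -stat; apply/eqP.
  by rewrite [x - mu]addrC addrK; congr (_ - b); rewrite addrAC.
rewrite [LHS]mx11_scalar; congr (_%:M); rewrite mxE -[RHS]sum1.
by apply: eq_bigr => i _; rewrite mxE mul1r.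
Qed.

Lemma KKT_supp_neq0 (R : realType) (n : nat) (M : 'M[R]_n) (b x mu : 'cV[R]_n)
    mu0 :
  KKT M b x mu0 mu -> supp_set x != set0.
Proof.
case=> _ sum1 _ _ _; apply/eqP => S0.
suff : (1 : R) == 0 by rewrite oner_eq0.
rewrite -sum1 big1 // => i _.
by have := in_set0 i; rewrite -S0 inE => /negbFE/eqP.
Qed.

Lemma kkt_mx_A_at (R : realType) (n : nat) (S : {set 'I_n}) (A : 'M[R]_n)
    (g : 'cV[R]_n) lam :
  kkt_mx S (A_at A g lam) =
  kkt_mx S A + lam *: (col_mx g 0 *m row_mx (g^T *m supp_proj S) (0 : 'M_1)).
Proof.
rewrite mul_col_row !mul0mx mulmx0 scale_block_mx !scaler0 add_block_mx.
rewrite !addr0 /kkt_mx; congr block_mx.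
by rewrite /A_at mulmxDl -scalemxAl mulmxA addrAC.
Qed.

(** * Reading off the stacked vector *)

(** Restricting [y = x - mu] to [S] gives [x_S], and restricting it to the
    complement gives [- mu_{S^c}]; the sign convention of [stack] then asks
    for [- y] in the place of [mu]. *)
Definition stack_of (R : realType) (n : nat) (S : {set 'I_n})
    (z : 'cV[R]_(n + 1)) : 'cV[R]_(n + 1) :=
  stack S (usubmx z) (- usubmx z) (dsubmx z 0 0).

Lemma stack_of_is_linear (R : realType) (n : nat) (S : {set 'I_n}) :
  linear (@stack_of R n S).
Proof.
move=> a z w; rewrite /stack_of /stack.
apply/matrixP => i j; rewrite !(castmxE, mxE).
case: splitP => k _; last by rewrite !ord1 !mxE.
by rewrite !mxE; case: splitP => k' _; rewrite !mxE // !opprK.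
Qed.

HB.instance Definition _ (R : realType) (n : nat) (S : {set 'I_n}) :=
  GRing.isLinear.Build R 'cV[R]_(n + 1) 'cV[R]_(n + 1) _ (@stack_of R n S)
    (@stack_of_is_linear R n S).

Lemma stack_kkt_vec (R : realType) (n : nat) (M : 'M[R]_n) (b x mu : 'cV[R]_n)
    mu0 :
  KKT M b x mu0 mu ->
  stack (supp_set x) x mu mu0 = stack_of (supp_set x) (kkt_vec x mu mu0).
Proof.
case=> _ _ compl _ _; rewrite /stack_of /kkt_vec col_mxKu col_mxKd /stack.
congr (castmx _ (col_mx (col_mx _ _) _)); last by rewrite mxE.
  apply/matrixP=> i j; rewrite ord1 !mxE.
  have := enum_valP i; rewrite inE => xi0.
  move/eqP: (compl (enum_val i)).
  by rewrite mulf_eq0 (negPf xi0) orbF => /eqP->; rewrite subr0.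
apply/matrixP=> i j; rewrite ord1 !mxE opprK.
by have := enum_valP i; rewrite !inE negbK => /eqP->; rewrite sub0r.
Qed.

(** * Rationality in lambda, affinity in rho *)

Theorem theorem1 (R : realType) (n : nat) (A : 'M[R]_n) (r g l : 'cV[R]_n)
    (hA : spd A) :
  (forall rho : R, 0 <= rho <= 1 ->
   forall S : {set 'I_n},
   exists (u1 u2 : 'cV[R]_(n + 1)) (D1 D2 : R),
   forall (lam : R) (x mu : 'cV[R]_n) (mu0 : R),
     0 <= lam <= 1 ->
     is_solution (A_at A g lam) (r_at r l rho) x mu0 mu ->
     supp_set x = S ->
     D1 - D2 * lam != 0 /\
     stack S x mu mu0 = (D1 - D2 * lam)^-1 *: (u1 - lam *: u2))
  /\
  (forall lam : R, 0 <= lam <= 1 ->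
   forall S : {set 'I_n},
   exists (v1 v2 : 'cV[R]_(n + 1)),
   forall (rho : R) (x mu : 'cV[R]_n) (mu0 : R),
     0 <= rho <= 1 ->
     is_solution (A_at A g lam) (r_at r l rho) x mu0 mu ->
     supp_set x = S ->
     stack S x mu mu0 = v1 - rho *: v2).
Proof.
split.
- move=> rho _ S.
  pose K := kkt_mx S A.
  pose q : 'rV[R]_(n + 1) := row_mx (g^T *m supp_proj S) (0 : 'M_1).
  pose a := invmx K *m kkt_rhs (r_at r l rho).
  pose b := invmx K *m col_mx g (0 : 'M_1).
  pose qa := (q *m a) 0 0; pose qb := (q *m b) 0 0.
  exists (stack_of S a), (stack_of S (qa *: b - qb *: a)), 1, (- qb).
  move=> lam x mu mu0 /andP[lam0 _] [_ kkt] xS.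
  have S0 := KKT_supp_neq0 kkt.
  have sol := kkt_mx_sol kkt.
  have Klam := kkt_mx_unit (spd_A_at g hA lam0) S0.
  rewrite -xS (stack_kkt_vec kkt) xS.
  rewrite xS in S0 sol Klam.
  rewrite kkt_mx_A_at in sol Klam.
  have [D0 zE] :=
    rank_one_update_sol (kkt_mx_unit hA S0) Klam sol.
  rewrite mulNr opprK [qb * lam]mulrC; split=> //.
  by rewrite {1}zE linearZ linearB linearZ.
- move=> lam /andP[lam0 _] S.
  pose K := kkt_mx S (A_at A g lam).
  exists (stack_of S (invmx K *m kkt_rhs r)),
         (- stack_of S (invmx K *m col_mx l (0 : 'M_1))).
  move=> rho x mu mu0 _ [_ kkt] xS.
  have S0 := KKT_supp_neq0 kkt.
  have sol := kkt_mx_sol kkt.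
  have Ku := kkt_mx_unit (spd_A_at g hA lam0) S0.
  rewrite -xS (stack_kkt_vec kkt) xS.
  rewrite xS in sol Ku.
  have rhsE : kkt_rhs (r_at r l rho) = kkt_rhs r + rho *: col_mx l (0 : 'M_1).
    by rewrite /kkt_rhs /r_at scale_col_mx scaler0 add_col_mx addr0.
  rewrite scalerN opprK -linearZ -linearD; congr stack_of.
  by rewrite scalemxAr -mulmxDr -rhsE -sol mulKmx.
Qed.
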